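(* Let $\mu\in\mathcal P$. (i) For the standard RB reduced functional $\hat J_r$, $$|\hat{\mathcal J}_h(\mu)-\hat J_r(\mu)|\le \Delta_{\hat J_r}(\mu) := \Delta_{\mathrm{pr}}(\mu)\,\|r^{\mathrm{du}}_\mu(u_{r,\mu},p_{r,\mu})\| + \Delta_{\mathrm{pr}}(\mu)^2\,\gamma_{k_\mu} + \big|r^{\mathrm{pr}}_\mu(u_{r,\mu})[p_{r,\mu}]\big|.$$ (ii) Furthermore, for the NCD-corrected RB reduced functional $\hat{\mathcal J}_r$ (or equivalently for the Lagrangian for any $p\in V_h$), $$|\hat{\mathcal J}_h(\mu)-\hat{\mathcal J}_r(\mu)| = |\mathcal L(u_{h,\mu},\mu,p)-\mathcal L(u_{r,\mu},\mu,p)|\le \Delta_{\hat{\mathcal J}_r}(\mu) := \Delta_{\mathrm{pr}}(\mu)\,\|r^{\mathrm{du}}_\mu(u_{r,\mu},p_{r,\mu})\| + \Delta_{\mathrm{pr}}(\mu)^2\,\gamma_{k_\mu}.$$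
   Context: Setting. Let $P\in\mathbb N$, $\mu_{\mathsf a},\mu_{\mathsf b}\in\mathbb R^P$, and $\mathcal P=\{\mu\in\mathbb R^P: \mu_{\mathsf a}\le\mu\le\mu_{\mathsf b}\}$ (componentwise). $V$ is a real Hilbert space with norm $\|\cdot\|$, and $V_h\subset V$ is a finite-dimensional subspace. For each $\mu\in\mathcal P$: $a_\mu:V\times V\to\mathbb R$ is a continuous, coercive, symmetric bilinear form; $l_\mu,j_\mu\in V'$; $k_\mu:V\times V\to\mathbb R$ is a continuous symmetric bilinear form; $\Theta:\mathcal P\to\mathbb R$. All forms are parameter separable, i.e. $a_\mu=\sum_{\xi}\theta^a_\xi(\mu)a_\xi$ is a finite sum with parameter-independent components $a_\xi$ and real-valued coefficient functions $\theta^a_\xi$ on $\mathcal P$, and similarly for $l_\mu,j_\mu,k_\mu$. The cost functional is $\mathcal J(u,\mu)=\Theta(\mu)+j_\mu(u)+k_\mu(u,u)$. Residuals and Lagrangian. $r^{\mathrm{pr}}_\mu(u)[v]=l_\mu(v)-a_\mu(u,v)$; $r^{\mathrm{du}}_\mu(u,p)[v]=j_\mu(v)+2k_\mu(v,u)-a_\mu(v,p)$; $\mathcal L(u,\mu,p)=\mathcal J(u,\mu)+r^{\mathrm{pr}}_\mu(u)[p]$. Full order model. $u_{h,\mu}\in V_h$ solves $a_\mu(u_{h,\mu},v_h)=l_\mu(v_h)$ for all $v_h\in V_h$, and $\hat{\mathcal J}_h(\mu)=\mathcal J(u_{h,\mu},\mu)$. Reduced basis (RB) model. Let $V_r^{\mathrm{pr}},V_r^{\mathrm{du}}\subset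 V_h$ be (possibly different) low-dimensional linear subspaces. $u_{r,\mu}\in V_r^{\mathrm{pr}}$ solves $a_\mu(u_{r,\mu},v_r)=l_\mu(v_r)$ for all $v_r\in V_r^{\mathrm{pr}}$; $p_{r,\mu}\in V_r^{\mathrm{du}}$ solves $a_\mu(q_r,p_{r,\mu})=j_\mu(q_r)+2k_\mu(q_r,u_{r,\mu})$ for all $q_r\in V_r^{\mathrm{du}}$. The standard RB reduced functional is $\hat J_r(\mu)=\mathcal J(u_{r,\mu},\mu)$. The NCD-corrected (non-conforming dual corrected) RB reduced functional is $\hat{\mathcal J}_r(\mu)=\mathcal L(u_{r,\mu},\mu,p_{r,\mu})=\hat J_r(\mu)+r^{\mathrm{pr}}_\mu(u_{r,\mu})[p_{r,\mu}]$. Norms and constants. Norms of residuals are dual norms in $V_h'$ with respect to $\|\cdot\|$; $\gamma_{k_\mu}$ is the continuity constant (operator norm) of $k_\mu$ on $V_h\times V_h$; $\underline{a_\mu}>0$ is the coercivity constant of $a_\mu$ on $V_h$ with respect to $\|\cdot\|$. $\Delta_{\mathrm{pr}}(\mu)=\underline{a_\mu}^{-1}\|r^{\mathrm{pr}}_\mu(u_{r,\mu})\|$.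
   Formalization: In (ii), the claim for arbitrary p in V_h is false as displayed; it is proved with p replacing p_r throughout, i.e. for L(u_r,μ,p) in place of the NCD-corrected functional and with r^du(u_r,p) in the bound; the display itself is proved at p = p_r. *)

(* Defs.v *)
From HB Require Import structures.
From mathcomp Require Export all_boot all_order all_algebra.
From mathcomp Require Export sesquilinear.
From mathcomp Require Export boolp classical_sets functions reals topology normedtype.
Export Order.TTheory GRing.Theory Num.Theory.
Export numFieldNormedType.Exports.

Set Implicit Arguments.
Unset Strict Implicit.
Unset Printing Implicit Defensive.

#[export] Set Implicit Arguments.

Local Open Scope classical_set_scope.
Local Open Scope ring_scope.

Section Forms.
Context {R : realType} {V : normedModType R}.
Implicit Types (l : V -> R) (b : V -> V -> R) (W : set V).

Definition continuous_functional l : Prop :=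
  GRing.linear_for *%R l /\ continuous l.

Definition continuous_bilinear b : Prop :=
  bilinear_for *%R *%R b /\ continuous (fun z : V * V => b z.1 z.2).

Definition symmetric_form b : Prop := forall u v, b u v = b v u.

Definition coercive b : Prop :=
  exists2 c : R, 0 < c & forall v, c * `|v| ^+ 2 <= b v v.

Definition linear_subspace W : Prop := GRing.submod_closed (mem W).

Definition finite_dim_subspace W : Prop :=
  exists (n : nat) (e : 'I_n -> V),
    W = [set \sum_(i < n) c i *: e i | c in [set: 'I_n -> R]].

(* If W = {0}, the index sets below are empty and the three constants are 0,
   since sup set0 = inf set0 = 0. *)

Definition dual_norm W l : R :=
  sup [set `|l v| / `|v| | v in W `\ 0].

Definition continuity_constant W b : R :=
  sup [set `|b z.1 z.2| / (`|z.1| * `|z.2|) | z in (W `\ 0) `*` (W `\ 0)].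

Definition coercivity_constant W b : R :=
  inf [set b v v / `|v| ^+ 2 | v in W `\ 0].

End Forms.

Definition parameter_box {R : realType} {P : nat} (mua mub : 'rV[R]_P) :
    set 'rV[R]_P :=
  [set mu | forall i, mua 0 i <= mu 0 i <= mub 0 i].

(* The data are total functions of the parameter; assumptions on them are only
   ever made for parameters in the admissible set. *)
Record problem (R : realType) (V : normedModType R) (P : nat) := Problem {
  Theta : 'rV[R]_P -> R;
  form_a : 'rV[R]_P -> V -> V -> R;
  form_l : 'rV[R]_P -> V -> R;
  form_j : 'rV[R]_P -> V -> R;
  form_k : 'rV[R]_P -> V -> V -> R }.

Section Separability.
Context {R : realType} {V : normedModType R} {P : nat}.
Variable D : set 'rV[R]_P.

Definition separable_functional (l : 'rV[R]_P -> V -> R) : Prop :=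
  exists (n : nat) (theta : 'I_n -> 'rV[R]_P -> R) (c : 'I_n -> V -> R),
    (forall q, continuous_functional (c q)) /\
    forall mu, D mu -> forall v, l mu v = \sum_(q < n) theta q mu * c q v.

Definition separable_bilinear (b : 'rV[R]_P -> V -> V -> R) : Prop :=
  exists (n : nat) (theta : 'I_n -> 'rV[R]_P -> R) (c : 'I_n -> V -> V -> R),
    (forall q, continuous_bilinear (c q)) /\
    forall mu, D mu -> forall u v,
      b mu u v = \sum_(q < n) theta q mu * c q u v.

Definition admissible_problem (pb : problem V P) : Prop :=
  (forall mu, D mu ->
    [/\ continuous_bilinear (form_a pb mu), coercive (form_a pb mu)
      & symmetric_form (form_a pb mu)] /\
    [/\ continuous_functional (form_l pb mu),
        continuous_functional (form_j pb mu),
        continuous_bilinear (form_k pb mu)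
      & symmetric_form (form_k pb mu)]) /\
  [/\ separable_bilinear (form_a pb), separable_functional (form_l pb),
      separable_functional (form_j pb) & separable_bilinear (form_k pb)].

End Separability.

Section ReducedBasis.
Context {R : realType} {V : normedModType R} {P : nat}.
Variable pb : problem V P.
Implicit Types (mu : 'rV[R]_P) (u v p : V) (W : set V).

Definition cost u mu : R :=
  Theta pb mu + form_j pb mu u + form_k pb mu u u.

Definition primal_residual mu u : V -> R :=
  fun v => form_l pb mu v - form_a pb mu u v.

Definition dual_residual mu u p : V -> R :=
  fun v => form_j pb mu v + 2 * form_k pb mu v u - form_a pb mu v p.

Definition lagrangian u mu p : R := cost u mu + primal_residual mu u p.

Definition primal_solution W mu u : Prop :=
  W u /\ forall v, W v -> form_a pb mu u v = form_l pb mu v.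

Definition dual_solution W mu u p : Prop :=
  W p /\ forall q, W q ->
    form_a pb mu q p = form_j pb mu q + 2 * form_k pb mu q u.

Variables (Vh : set V) (uh ur pr : 'rV[R]_P -> V).

Definition full_functional mu : R := cost (uh mu) mu.

Definition standard_rb_functional mu : R := cost (ur mu) mu.

Definition ncd_rb_functional mu : R := lagrangian (ur mu) mu (pr mu).

Definition primal_estimate mu : R :=
  (coercivity_constant Vh (form_a pb mu))^-1 *
  dual_norm Vh (primal_residual mu (ur mu)).

(* The bound of the corrected functional with an arbitrary p in place of the
   reduced dual solution. *)
Definition lagrangian_estimate mu p : R :=
  primal_estimate mu * dual_norm Vh (dual_residual mu (ur mu) p) +
  primal_estimate mu ^+ 2 * continuity_constant Vh (form_k pb mu).

Definition ncd_rb_estimate mu : R := lagrangian_estimate mu (pr mu).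

Definition standard_rb_estimate mu : R :=
  primal_estimate mu * dual_norm Vh (dual_residual mu (ur mu) (pr mu)) +
  primal_estimate mu ^+ 2 * continuity_constant Vh (form_k pb mu) +
  `|primal_residual mu (ur mu) (pr mu)|.

End ReducedBasis.

(* Main.v *)
From mathcomp Require Import ring lra prodnormedzmodule.
Require Import Defs.
Unset Strict Implicit.
Local Open Scope classical_set_scope.
Local Open Scope ring_scope.

(** The error [e = uh - ur] lies in [Vh] and satisfies
    [a e e = primal_residual ur e], so coercivity bounds [`|e|] by the primal
    estimate. Since [k] is symmetric, the Lagrangian is quadratic in the state:
    its increment from [ur] to [uh] is exactly
    [dual_residual ur p e + k e e]. *)

(** * Arithmetic of linear functionals *)

Section LinearFor.
Context {R : nzRingType} {V : lmodType R} (l : V -> R).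
Hypothesis l_lin : GRing.linear_for *%R l.

Lemma linear_for_add u v : l (u + v) = l u + l v.
Proof. by rewrite -[u in LHS]scale1r l_lin mul1r. Qed.

Lemma linear_for_zero : l 0 = 0.
Proof. by apply: (addrI (l 0)); rewrite -linear_for_add !addr0. Qed.

Lemma linear_for_scale c v : l (c *: v) = c * l v.
Proof. by rewrite -[c *: v]addr0 l_lin linear_for_zero addr0. Qed.

Lemma linear_for_sub u v : l (u - v) = l u - l v.
Proof. by rewrite linear_for_add -scaleN1r linear_for_scale mulN1r. Qed.

End LinearFor.

(** * Boundedness of continuous forms, and the constants defined by suprema and infima *)

Section FormBounds.
Context {R : realType} {V : normedModType R}.
Implicit Types (l : V -> R) (b : V -> V -> R) (W : set V).

Lemma rescaled_norm (r : R) (v : V) : 0 < r -> v != 0 ->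
  `|(r / `|v|) *: v| = r.
Proof.
move=> r0 v0; rewrite normrZ ger0_norm ?divfK ?normr_eq0//.
by rewrite divr_ge0 // ltW.
Qed.

(** Continuity at 0 gives a ball on which [l] stays below 1 in absolute value; every nonzero vector
    is rescaled into that ball and homogeneity does the rest. *)
Lemma continuous_functional_bounded l : continuous_functional l ->
  exists M, forall v, `|l v| <= M * `|v|.
Proof.
move=> [l_lin l_cont].
have l0 := linear_for_zero l_lin.
have := @cvgr0_norm_lt _ _ _ (nbhs (0 : V)) _ l.
rewrite -[X in _ --> X]l0 => /(_ _ (l_cont 0) 1 ltr01) /nbhs_norm0P[d /= d0 dP].
have r0 : 0 < d / 2 by rewrite divr_gt0.
(* Vectors are rescaled to norm [d / 2], strictly inside the open ball of radius [d]. *)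
exists (d / 2)^-1 => v; have [->|v0] := eqVneq v 0.
  by rewrite l0 !normr0 mulr0.
have v_gt0 : 0 < `|v| by rewrite normr_gt0.
have /dP : `|(d / 2 / `|v|) *: v| < d by rewrite rescaled_norm//; lra.
rewrite /= linear_for_scale// normrM gtr0_norm ?divr_gt0// => /ltW.
by rewrite mulrAC ler_pdivrMr// mul1r mulrC -ler_pdivlMr// mulrC.
Qed.

Lemma continuous_bilinear_bounded b : continuous_bilinear b ->
  exists M, forall u v, `|b u v| <= M * (`|u| * `|v|).
Proof.
move=> [[b_linl b_linr] b_cont].
have bl0 v : b 0 v = 0 := linear_for_zero (b_linl v).
have br0 u : b u 0 = 0 := linear_for_zero (b_linr u).
have := @cvgr0_norm_lt _ _ _ (nbhs (0 : V * V)) _ (fun z => b z.1 z.2).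
rewrite -[X in _ --> X](bl0 0) => /(_ _ (b_cont 0) 1 ltr01) /nbhs_norm0P[d /= d0 dP].
have r0 : 0 < d / 2 by rewrite divr_gt0.
(* The constant is squared because both arguments get rescaled to norm [d / 2]. *)
exists ((d / 2)^-1 ^+ 2) => u v; have [->|u0] := eqVneq u 0.
  by rewrite bl0 !normr0 mul0r mulr0.
have [->|v0] := eqVneq v 0; first by rewrite br0 !normr0 !mulr0.
have u_gt0 : 0 < `|u| by rewrite normr_gt0.
have v_gt0 : 0 < `|v| by rewrite normr_gt0.
have r_lt : d / 2 < d by lra.
have := dP ((d / 2 / `|u|) *: u, (d / 2 / `|v|) *: v).
(* The norm of [V * V] is the maximum of the two norms, so the rescaled pair again has norm
   [d / 2]. *)
rewrite /= prod_normE /= !rescaled_norm// maxxx => /(_ r_lt).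
rewrite (linear_for_scale (b_linl _)) normrM (gtr0_norm (divr_gt0 r0 u_gt0)).
rewrite (linear_for_scale (b_linr _)) normrM (gtr0_norm (divr_gt0 r0 v_gt0)).
move=> /ltW buv.
rewrite exprVn mulrC ler_pdivlMr ?exprn_gt0//.
rewrite -[leRHS]mulr1 -ler_pdivrMl ?mulr_gt0//; apply: le_trans buv.
by rewrite le_eqVlt; apply/orP; left; apply/eqP; field; rewrite !gt_eqF.
Qed.

Lemma dual_norm_ge0 W l : 0 <= dual_norm W l.
Proof.
(* An empty or unbounded set of quotients has supremum 0 by convention. *)
have [hs|/sup_out] := pselect (has_sup [set `|l v| / `|v| | v in W `\ 0]);
  last by rewrite /dual_norm => ->.
case: (hs) => -[x /[dup] Ex [v _ vx]] _.
by apply: le_trans (sup_upper_bound hs Ex); rewrite -vx divr_ge0.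
Qed.

(** The bound [M] makes the set of quotients bounded, so that its [sup] is a true upper bound and
    not the default value 0. At [v = 0], which the quotients omit, [M] forces [l 0 = 0]. *)
Lemma le_dual_norm W l (M : R) : (forall v, `|l v| <= M * `|v|) ->
  forall v, W v -> `|l v| <= dual_norm W l * `|v|.
Proof.
move=> lM v Wv; have [->|v0] := eqVneq v 0.
  by have := lM 0; rewrite normr0 !mulr0.
rewrite -ler_pdivrMr ?normr_gt0//; apply: ub_le_sup.
  exists M => _ [w [_ /eqP w0] <-]; rewrite ler_pdivrMr ?normr_gt0//.
by exists v => //; split=> //; apply/eqP.
Qed.

Lemma le_continuity_constant W b : continuous_bilinear b ->
  forall u v, W u -> W v -> `|b u v| <= continuity_constant W b * (`|u| * `|v|).
Proof.
move=> /continuous_bilinear_bounded[M bM] u v Wu Wv.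
have [u0|u0] := eqVneq u 0.
  by have := bM u v; rewrite u0 normr0 mul0r !mulr0.
have [v0|v0] := eqVneq v 0.
  by have := bM u v; rewrite v0 normr0 !mulr0.
rewrite -ler_pdivrMr ?mulr_gt0 ?normr_gt0//; apply: ub_le_sup.
  exists M => _ [[x y] [[_ /eqP /= x0] [_ /eqP /= y0]] <-] /=.
  by rewrite ler_pdivrMr ?mulr_gt0 ?normr_gt0.
by exists (u, v) => //; split; split=> //; apply/eqP.
Qed.

Lemma continuity_constant_ge0 W b : 0 <= continuity_constant W b.
Proof.
rewrite /continuity_constant; set E := (X in sup X).
have [hs|/sup_out->//] := pselect (has_sup E).
case: (hs) => -[x /[dup] Ex [z _ zx]] _.
by apply: le_trans (sup_upper_bound hs Ex); rewrite -zx divr_ge0 // mulr_ge0.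
Qed.

(** The nonzero [v] keeps the set of quotients nonempty; any coercivity constant on [V] is then a
    positive lower bound of it. *)
Lemma coercivity_constant_gt0 W b v : coercive b -> W v -> v != 0 ->
  0 < coercivity_constant W b.
Proof.
move=> [c c0 bc] Wv v0; apply: (lt_le_trans c0); apply: lb_le_inf.
  by exists (b v v / `|v| ^+ 2); exists v => //; split=> //; apply/eqP.
move=> _ [w [_ /eqP w0] <-].
by rewrite ler_pdivlMr ?exprn_gt0 ?normr_gt0.
Qed.

Lemma coercivity_constant_ge0 W b : coercive b -> 0 <= coercivity_constant W b.
Proof.
move=> b_coer; rewrite /coercivity_constant; set E := (X in inf X).
have [hs|/inf_out->//] := pselect (has_inf E).
case: (hs) => -[_ [v [Wv /eqP v0] _]] _.
exact: ltW (coercivity_constant_gt0 b_coer Wv v0).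
Qed.

(** Coercivity bounds the quotients from below, so their [inf] is a true lower bound; [b 0 0 = 0]
    settles the vector that the quotients omit. *)
Lemma coercivity_constant_le W b v : coercive b -> W v ->
  b 0 0 = 0 -> coercivity_constant W b * `|v| ^+ 2 <= b v v.
Proof.
move=> [c c0 bc] Wv b0; have [->|v0] := eqVneq v 0.
  by rewrite normr0 expr0n mulr0 b0.
rewrite -ler_pdivlMr ?exprn_gt0 ?normr_gt0//; apply: ge_inf.
  exists c => _ [w [_ /eqP w0] <-].
  by rewrite ler_pdivlMr ?exprn_gt0 ?normr_gt0.
by exists v => //; split=> //; apply/eqP.
Qed.

Lemma finite_dim_subspaceB W u v : finite_dim_subspace W ->
  W u -> W v -> W (u - v).
Proof.
move=> [n [e ->]] [c _ <-] [d _ <-]; exists (fun i => c i - d i) => //.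
by rewrite -sumrB; apply: eq_bigr => i _; rewrite scalerBl.
Qed.

End FormBounds.

(** * Error estimates at a fixed parameter *)

Section Estimates.
Context {R : realType} {V : normedModType R} {P : nat}.
Variables (pb : problem V P) (mu : 'rV[R]_P).
Local Notation a := (form_a pb mu).
Local Notation l := (form_l pb mu).
Local Notation j := (form_j pb mu).
Local Notation k := (form_k pb mu).
Hypotheses (a_cont : continuous_bilinear a) (a_coer : coercive a).
Hypothesis l_cont : continuous_functional l.
Hypotheses (j_cont : continuous_functional j).
Hypotheses (k_cont : continuous_bilinear k) (k_sym : symmetric_form k).

Lemma primal_residual_bounded u :
  exists M, forall v, `|primal_residual pb mu u v| <= M * `|v|.
Proof.
have [Ml lM] := continuous_functional_bounded l_cont.
have [Ma aM] := continuous_bilinear_bounded a_cont.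
exists (Ml + Ma * `|u|) => v; rewrite mulrDl -mulrA.
by apply: (le_trans (ler_normB _ _)); rewrite lerD.
Qed.

Lemma dual_residual_bounded u p :
  exists M, forall v, `|dual_residual pb mu u p v| <= M * `|v|.
Proof.
have [Mj jM] := continuous_functional_bounded j_cont.
have [Ma aM] := continuous_bilinear_bounded a_cont.
have [Mk kM] := continuous_bilinear_bounded k_cont.
exists (Mj + 2 * Mk * `|u| + Ma * `|p|) => v.
apply: (le_trans (ler_normB _ _)); rewrite [leRHS]mulrDl lerD//; last first.
  by rewrite -mulrA [`|p| * _]mulrC.
apply: (le_trans (ler_normD _ _)); rewrite [leRHS]mulrDl lerD//.
by rewrite normrM normr_nat -!mulrA ler_pM2l // [`|u| * _]mulrC.
Qed.

(** The terms [l p] cancel. With [e = u' - u], symmetry gives [k u' u' - k u u = 2 * k e u + k e e],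
    which explains the factor 2 in the dual residual. *)
Lemma lagrangian_increment u u' p :
  lagrangian pb u' mu p - lagrangian pb u mu p =
  dual_residual pb mu u p (u' - u) + k (u' - u) (u' - u).
Proof.
rewrite /lagrangian /cost /primal_residual /dual_residual.
have [[al _] _] := a_cont; have [[kl kr] _] := k_cont.
rewrite (linear_for_sub (proj1 j_cont)) (linear_for_sub (al p)).
rewrite (linear_for_sub (kl u)) (linear_for_sub (kl (u' - u))).
rewrite !(linear_for_sub (kr _)) (k_sym u u'); ring.
Qed.

Variables (Vh : set V) (uh ur : 'rV[R]_P -> V).
Hypotheses (Vh_fin : finite_dim_subspace Vh).
Hypotheses (uh_sol : primal_solution pb Vh mu (uh mu)) (Vh_ur : Vh (ur mu)).

Lemma primal_estimate_ge0 : 0 <= primal_estimate pb Vh ur mu.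
Proof.
by rewrite mulr_ge0 ?invr_ge0 ?coercivity_constant_ge0 ?dual_norm_ge0.
Qed.

Lemma primal_error_le : `|uh mu - ur mu| <= primal_estimate pb Vh ur mu.
Proof.
have [Vh_uh uh_eq] := uh_sol.
have Vh_e : Vh (uh mu - ur mu) by exact: finite_dim_subspaceB.
have [[al ar] _] := a_cont.
(* A nonzero error shows that [Vh] is not trivial, hence that the coercivity constant is positive
   and can be moved across the inequality. *)
have [e0|e0] := eqVneq (uh mu - ur mu) 0.
  by rewrite e0 normr0 primal_estimate_ge0.
rewrite ler_pdivlMl ?(coercivity_constant_gt0 a_coer Vh_e)//.
(* Multiplying by the norm of the error turns the goal into a chain: coercivity on the left, the
   dual norm bound on the right, and the residual at the error in between. *)
rewrite -(@ler_pM2r _ `|uh mu - ur mu|) ?normr_gt0// -mulrA -expr2.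
apply: le_trans (coercivity_constant_le a_coer Vh_e (linear_for_zero (al 0))) _.
rewrite [leLHS](linear_for_sub (al _)) uh_eq//.
have [M rM] := primal_residual_bounded (ur mu).
exact: le_trans (ler_norm _) (le_dual_norm rM Vh_e).
Qed.

Lemma lagrangian_error_le p :
  `|lagrangian pb (uh mu) mu p - lagrangian pb (ur mu) mu p|
    <= lagrangian_estimate pb Vh ur mu p.
Proof.
have Vh_e : Vh (uh mu - ur mu).
  by apply: finite_dim_subspaceB => //; case: uh_sol.
rewrite lagrangian_increment; apply: (le_trans (ler_normD _ _)); apply: lerD.
  have [M rM] := dual_residual_bounded (ur mu) p.
  apply: (le_trans (le_dual_norm rM Vh_e)).
  by rewrite mulrC ler_wpM2r ?dual_norm_ge0 ?primal_error_le.
apply: (le_trans (le_continuity_constant k_cont Vh_e Vh_e)).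
rewrite mulrC ler_wpM2r ?continuity_constant_ge0// -expr2.
by rewrite lerXn2r ?nnegrE ?primal_estimate_ge0 ?primal_error_le.
Qed.

(** The primal residual of [uh mu] vanishes on [Vh], so the Lagrangian there does not depend on
    [p]. *)
Lemma full_functionalE p : Vh p ->
  full_functional pb uh mu = lagrangian pb (uh mu) mu p.
Proof.
move=> Vhp; have [_ uh_eq] := uh_sol.
by rewrite /lagrangian /primal_residual uh_eq// subrr addr0.
Qed.

End Estimates.

Theorem proposition2p5 (R : realType) (V : completeNormedModType R)
    (ip : {dot V for idfun}) (hip : forall v : V, ip v v = `|v| ^+ 2)
    (P : nat) (mua mub : 'rV[R]_P) (pb : problem V P)
    (hpb : admissible_problem (parameter_box mua mub) pb)
    (Vh Vpr Vdu : set V)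
    (hVh : finite_dim_subspace Vh)
    (hVpr : linear_subspace Vpr) (hVpr_sub : Vpr `<=` Vh)
    (hVdu : linear_subspace Vdu) (hVdu_sub : Vdu `<=` Vh)
    (uh ur pr : 'rV[R]_P -> V)
    (huh : forall mu, parameter_box mua mub mu ->
      primal_solution pb Vh mu (uh mu))
    (hur : forall mu, parameter_box mua mub mu ->
      primal_solution pb Vpr mu (ur mu))
    (hpr : forall mu, parameter_box mua mub mu ->
      dual_solution pb Vdu mu (ur mu) (pr mu))
    (mu : 'rV[R]_P) (hmu : parameter_box mua mub mu) :
  (* (i) *)
  `|full_functional pb uh mu - standard_rb_functional pb ur mu|
    <= standard_rb_estimate pb Vh ur pr mu /\
  (* (ii) *)
  (`|full_functional pb uh mu - ncd_rb_functional pb ur pr mu|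
     = `|lagrangian pb (uh mu) mu (pr mu) - lagrangian pb (ur mu) mu (pr mu)| /\
   `|lagrangian pb (uh mu) mu (pr mu) - lagrangian pb (ur mu) mu (pr mu)|
     <= ncd_rb_estimate pb Vh ur pr mu) /\
  (* (ii), for the Lagrangian at an arbitrary p in Vh *)
  (forall p : V, Vh p ->
    `|full_functional pb uh mu - lagrangian pb (ur mu) mu p|
      = `|lagrangian pb (uh mu) mu p - lagrangian pb (ur mu) mu p| /\
    `|lagrangian pb (uh mu) mu p - lagrangian pb (ur mu) mu p|
      <= lagrangian_estimate pb Vh ur mu p).
Proof.
have [/(_ mu hmu)[[a_cont a_coer _] [l_cont j_cont k_cont k_sym]] _] := hpb.
have Vh_ur : Vh (ur mu) by apply: hVpr_sub; case: (hur mu hmu).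
have Vh_pr : Vh (pr mu) by apply: hVdu_sub; case: (hpr mu hmu).
have uh_sol := huh mu hmu.
have bound p : `|lagrangian pb (uh mu) mu p - lagrangian pb (ur mu) mu p|
    <= lagrangian_estimate pb Vh ur mu p by exact: lagrangian_error_le.
split; last split.
(* The standard functional is the Lagrangian without its residual term, which accounts for the third
   summand of the estimate. *)
- have -> : full_functional pb uh mu - standard_rb_functional pb ur mu =
      lagrangian pb (uh mu) mu (pr mu) - lagrangian pb (ur mu) mu (pr mu)
      + primal_residual pb mu (ur mu) (pr mu).
    rewrite -(full_functionalE uh_sol Vh_pr) /standard_rb_functional.
    by rewrite /lagrangian; ring.
  by apply: (le_trans (ler_normD _ _)); rewrite lerD2r; exact: bound.
- by rewrite (full_functionalE uh_sol Vh_pr); split=> //; exact: bound.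
- by move=> p Vhp; rewrite (full_functionalE uh_sol Vhp).
Qed.
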